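(* Let $\Omega=\{x\in\mathbb{R}^d:0\le x\le\overline x\}$ for some $\overline x>0$, let $f$ and $g_1,\dots,g_m$ be CPWA functions on $\Omega$, assume $\phi(f)<\infty$ and $\phi(-f)<\infty$, and assume the no-arbitrage condition: for every $y\in\mathbb{R}^m$, if $\langle y,g\rangle-\pi(y)\ge0$ on $\Omega$ then $\langle y,g\rangle-\pi(y)=0$ on $\Omega$. Then the ECP Algorithm without radial constraints, described in the context, terminates after finitely many iterations, and, with $X$ denoting its output set, the linear program with decision variables $(\mu_x)_{x\in X}$ $$\text{maximize }\sum_{x\in X}\mu_xf(x)\quad\text{subject to}\quad\sum_{x\in X}\mu_x=1,\quad\underline\pi\le\sum_{x\in X}\mu_xg(x)\le\overline\pi,\quad\mu_x\ge0\ \ \forall x\in X$$ has an optimal solution $(\mu^\star_x)_{x\in X}$. Moreover, the finitely supported measure $\mu^\star:=\sum_{x\in X}\mu^\star_x\delta_x$ (where $\delta_x$ is the Dirac measure at $x$) is $\varepsilon$-optimal for $\sup_{\mu\in\mathcal{Q}}\int_\Omega f\,\mathrm{d}\mu$, i.e. $\mu^\star\in\mathcal{Q}$ and $\int_\Omega f\,\mathrm{d}\mu^\star\ge\sup_{\mu\in\mathcal{Q}}\int_\Omega f\,\mathrm{d}\mu-\varepsilon$.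
   Context: **Setting.** Vector inequalities are componentwise. A function $h$ is CPWA (continuous piece-wise affine) if $h(x)=\sum_{k=1}^K\xi_k\max\{\langle a_{k,i},x\rangle+b_{k,i}:1\le i\le I_k\}$ with $K,I_k\in\mathbb{N}$, $a_{k,i}\in\mathbb{R}^d$, $b_{k,i}\in\mathbb{R}$, $\xi_k\in\{-1,1\}$. Let $g=(g_1,\dots,g_m)^{\mathsf T}$ and let $\underline\pi_j\le\overline\pi_j$ be reals, $\overline\pi=(\overline\pi_j)_j,\underline\pi=(\underline\pi_j)_j$. For $y\in\mathbb{R}^m$, $\pi(y):=\sum_j(\max\{y_j,0\}\overline\pi_j-\max\{-y_j,0\}\underline\pi_j)$. For a function $f$ on $\Omega$, $$\phi(f):=\inf\{c+\pi(y):c\in\mathbb{R},\,y\in\mathbb{R}^m,\,c+\langle y,g(x)\rangle\ge f(x)\ \forall x\in\Omega\}.$$ $\mathcal{Q}$ is the set of Borel probability measures $\mu$ on $\Omega$ with $\underline\pi_j\le\int_\Omega g_j\,\mathrm{d}\mu\le\overline\pi_j$ for all $j$. Slack function: $s_y(x):=\langle y,g(x)\rangle-f(x)$, $x\in\Omega$. **Inputs.** $\overline\pi,\underline\pi,g,f,\overline x$; a finite (possibly empty) set $X^{(0)}\subset\Omega$; $\varepsilon>0$, $\tau>0$, $0<\delta\le1$; $\underline\phi:=-c_0-\pi(y_0)$, where $c_0\in\mathbb{R}$, $y_0\in\mathbb{R}^m$ satisfy $c_0+\langle y_0,g\rangle\ge-f$ on $\Omega$. **ECP Algorithm (without radial constraints).**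 1. Let $\sigma$ be the system of linear inequalities in variables $c\in\mathbb{R}$, $y^+,y^-\in\mathbb{R}^m$ consisting of $y^+\ge0$, $y^-\ge0$ and $c+\langle y^+,\overline\pi\rangle-\langle y^-,\underline\pi\rangle\ge\underline\phi-\tau$. Set $r\leftarrow0$. 2. Repeat: (a) for each $x\in X^{(r)}$ add $c+\langle y^+-y^-,g(x)\rangle\ge f(x)$ to $\sigma$; (b) solve the linear program: $\underline\varphi^{(r)}\leftarrow$ minimum of $c+\langle y^+,\overline\pi\rangle-\langle y^-,\underline\pi\rangle$ subject to $\sigma$, with computed minimizer $(c^{(r)},y^{+(r)},y^{-(r)})$; set $y^{(r)}\leftarrow y^{+(r)}-y^{-(r)}$; (c) $s^{(r)}\leftarrow c^{(r)}+\min_{0\le x\le\overline x}s_{y^{(r)}}(x)$ (computed by solving an equivalent mixed-integer linear program via branch-and-bound); (d) $X^{(r+1)}\leftarrow$ the finite set of those points $x\in\Omega$ belonging to integer feasible solutions found by branch-and-bound in (c) (these include a minimizer) that satisfy $c^{(r)}+s_{y^{(r)}}(x)\le\delta s^{(r)}$; (e) $r\leftarrow r+1$; until $s^{(r-1)}\ge-\varepsilon$. 3. Set $\phi(f)^{\mathrm{LB}}\leftarrow\underline\varphi^{(r-1)}$, $\phi(f)^{\mathrm{UB}}\leftarrow\underline\varphi^{(r-1)}-s^{(r-1)}$, $c^\star\leftarrow c^{(r-1)}-s^{(r-1)}$, $y^\star\leftarrow y^{(r-1)}$, $X\leftarrow\bigcup_{l=0}^{r-1}X^{(l)}$. 4.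 If $\phi(f)^{\mathrm{UB}}<\underline\phi$, report that the minimization problem defining $\phi(f)$ is unbounded; otherwise return $\phi(f)^{\mathrm{UB}},\phi(f)^{\mathrm{LB}},c^\star,y^\star,X$.
   Formalization: The claims about the linear program over X and the ε-optimality of μ* are stated under the extra condition ε < τ, since for every τ ≤ ε they can fail (f = g = 0, zero price bounds, empty X^(0) gives X empty); termination is stated for all ε, τ > 0. *)

(* Defs.v *)
From HB Require Import structures.
From mathcomp Require Import all_boot all_order all_algebra.
From mathcomp Require Import finmap.
From mathcomp Require Import all_classical all_reals all_analysis.

Set Implicit Arguments.
Unset Strict Implicit.
Unset Printing Implicit Defensive.

Import Order.TTheory GRing.Theory Num.Theory.
Import numFieldNormedType.Exports.

Local Open Scope classical_set_scope.
Local Open Scope ring_scope.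

Definition dotv (R : realType) (n : nat) (u v : 'rV[R]_n) : R :=
  \sum_(i < n) u 0 i * v 0 i.

Definition vle (R : realType) (n : nat) (u v : 'rV[R]_n) : Prop :=
  forall i, u 0 i <= v 0 i.

Definition vlt (R : realType) (n : nat) (u v : 'rV[R]_n) : Prop :=
  forall i, u 0 i < v 0 i.

Definition box (R : realType) (d : nat) (xbar : 'rV[R]_d) : set 'rV[R]_d :=
  [set x | vle 0 x /\ vle x xbar].

(* The [k]-th term is a maximum of [(I k).+1] affine functions. Taking the one
   of index 0 as the default value of the big operator adds nothing to it. *)
Definition cpwa_on (R : realType) (d : nat) (D : set 'rV[R]_d)
    (h : 'rV[R]_d -> R) : Prop :=
  exists (K : nat) (I : 'I_K -> nat) (a : 'I_K -> nat -> 'rV[R]_d)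
         (b : 'I_K -> nat -> R) (xi : 'I_K -> R),
    (forall k, xi k = 1 \/ xi k = -1) /\
    forall x, D x ->
      h x = \sum_(k < K) xi k *
        \big[Num.max/dotv (a k 0%N) x + b k 0%N]_(i < (I k).+1)
          (dotv (a k i) x + b k i).

(* [ecp_X0] is $X^{(0)}$, and [(ecp_c0, ecp_y0)] is the pair that defines
   $\underline\phi$. *)
Record ecp_input (R : realType) (d m : nat) := EcpInput {
  pi_hi : 'rV[R]_m;
  pi_lo : 'rV[R]_m;
  payoff : 'rV[R]_d -> 'rV[R]_m;
  target : 'rV[R]_d -> R;
  xbar : 'rV[R]_d;
  ecp_X0 : {fset 'rV[R]_d};
  ecp_eps : R;
  ecp_tau : R;
  ecp_delta : R;
  ecp_c0 : R;
  ecp_y0 : 'rV[R]_m }.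

Definition Omega (R : realType) (d m : nat) (I : ecp_input R d m) :
  set 'rV[R]_d := box (xbar I).

Definition price (R : realType) (d m : nat) (I : ecp_input R d m)
    (y : 'rV[R]_m) : R :=
  \sum_(j < m) (Num.max (y 0 j) 0 * pi_hi I 0 j
                - Num.max (- y 0 j) 0 * pi_lo I 0 j).

Definition phi (R : realType) (d m : nat) (I : ecp_input R d m)
    (h : 'rV[R]_d -> R) : \bar R :=
  ereal_inf [set z | exists (c : R) (y : 'rV[R]_m),
    (forall x, Omega I x -> h x <= c + dotv y (payoff I x)) /\
    z = (c + price I y)%:E].

Definition no_arbitrage (R : realType) (d m : nat) (I : ecp_input R d m) :
    Prop :=
  forall y : 'rV[R]_m,
    (forall x, Omega I x -> 0 <= dotv y (payoff I x) - price I y) ->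
    (forall x, Omega I x -> dotv y (payoff I x) - price I y = 0).

Definition slack (R : realType) (d m : nat) (I : ecp_input R d m)
    (y : 'rV[R]_m) (x : 'rV[R]_d) : R :=
  dotv y (payoff I x) - target I x.

Definition phi_low (R : realType) (d m : nat) (I : ecp_input R d m) : R :=
  - ecp_c0 I - price I (ecp_y0 I).

Definition lp_obj (R : realType) (d m : nat) (I : ecp_input R d m)
    (c : R) (yp ym : 'rV[R]_m) : R :=
  c + dotv yp (pi_hi I) - dotv ym (pi_lo I).

(* [lp_feasible I S] is the system sigma once the inequalities of the points of
   [S] have been added. The bound [phi_low I - ecp_tau I] makes the linear
   program solvable; under [no_arbitrage I], it is inactive when the loop stops
   provided that [ecp_eps I < ecp_tau I]. *)
Definition lp_feasible (R : realType) (d m : nat) (I : ecp_input R d m)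
    (S : {fset 'rV[R]_d}) (c : R) (yp ym : 'rV[R]_m) : Prop :=
  [/\ vle 0 yp, vle 0 ym,
      phi_low I - ecp_tau I <= lp_obj I c yp ym &
      forall x, x \in S -> target I x <= c + dotv (yp - ym) (payoff I x)].

Definition lp_minimizer (R : realType) (d m : nat) (I : ecp_input R d m)
    (S : {fset 'rV[R]_d}) (c : R) (yp ym : 'rV[R]_m) : Prop :=
  lp_feasible I S c yp ym /\
  forall c' yp' ym', lp_feasible I S c' yp' ym' ->
    lp_obj I c yp ym <= lp_obj I c' yp' ym'.

Definition is_minimum (R : realType) (T : Type) (D : set T) (h : T -> R)
    (v : R) : Prop :=
  (exists2 x, D x & h x = v) /\ forall x, D x -> v <= h x.

Record ecp_iterate (R : realType) (m : nat) := EcpIterate {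
  it_c : R;
  it_yp : 'rV[R]_m;
  it_ym : 'rV[R]_m;
  it_s : R }.

Definition it_y (R : realType) (m : nat) (t : ecp_iterate R m) : 'rV[R]_m :=
  it_yp t - it_ym t.

(* A pass through the loop body; [S] is the union of the $X^{(l)}$, $l \le r$,
   and [Xnext] is $X^{(r+1)}$. The solvers are nondeterministic: the linear
   program may return any of its minimizers, and branch-and-bound any finite set
   [found] of feasible points that contains a minimizer of the slack. *)
Definition ecp_body (R : realType) (d m : nat) (I : ecp_input R d m)
    (S : {fset 'rV[R]_d}) (t : ecp_iterate R m) (Xnext : {fset 'rV[R]_d}) :
    Prop :=
  lp_minimizer I S (it_c t) (it_yp t) (it_ym t) /\
  exists (v : R) (found : {fset 'rV[R]_d}),
    [/\ is_minimum (Omega I) (slack I (it_y t)) v,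
        it_s t = it_c t + v,
        (forall x, x \in found -> Omega I x),
        (exists2 x, x \in found & slack I (it_y t) x = v) &
        Xnext = [fset x in found |
                  (it_c t + slack I (it_y t) x <= ecp_delta I * it_s t)%R]%fset].

(* [ecp_terminates_from I S X]: with [S] the union of the $X^{(l)}$, $l < r$,
   and [X = X^{(r)}], the loop body can be carried out, and every execution of
   the loop that starts here reaches the stopping test with success. *)
Inductive ecp_terminates_from (R : realType) (d m : nat)
    (I : ecp_input R d m) (S X : {fset 'rV[R]_d}) : Prop :=
| EcpTerminatesFrom of
    (exists (t : ecp_iterate R m) (Xnext : {fset 'rV[R]_d}),
       ecp_body I (S `|` X)%fset t Xnext) &
    (forall (t : ecp_iterate R m) (Xnext : {fset 'rV[R]_d}),
       ecp_body I (S `|` X)%fset t Xnext -> it_s t < - ecp_eps I ->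
       ecp_terminates_from I (S `|` X)%fset Xnext).

Definition ecp_terminates (R : realType) (d m : nat) (I : ecp_input R d m) :
    Prop :=
  ecp_terminates_from I fset0 (ecp_X0 I).

(* The arguments of [EcpReturned] are the upper bound, the lower bound,
   $c^\star$, $y^\star$ and $X$. *)
Inductive ecp_result (R : realType) (d m : nat) :=
| EcpUnbounded
| EcpReturned of R & R & R & 'rV[R]_m & {fset 'rV[R]_d}.

Definition ecp_LB (R : realType) (d m : nat) (I : ecp_input R d m)
    (t : ecp_iterate R m) : R :=
  lp_obj I (it_c t) (it_yp t) (it_ym t).

Definition ecp_UB (R : realType) (d m : nat) (I : ecp_input R d m)
    (t : ecp_iterate R m) : R :=
  ecp_LB I t - it_s t.

Definition ecp_finish (R : realType) (d m : nat) (I : ecp_input R d m)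
    (t : ecp_iterate R m) (X : {fset 'rV[R]_d}) : ecp_result R d m :=
  if ecp_UB I t < phi_low I then EcpUnbounded R d m
  else EcpReturned (ecp_UB I t) (ecp_LB I t) (it_c t - it_s t) (it_y t) X.

Inductive ecp_outcome_from (R : realType) (d m : nat) (I : ecp_input R d m)
    (S X : {fset 'rV[R]_d}) : ecp_result R d m -> Prop :=
| EcpStop t Xnext of
    ecp_body I (S `|` X)%fset t Xnext & - ecp_eps I <= it_s t :
    ecp_outcome_from I S X (ecp_finish I t (S `|` X)%fset)
| EcpContinue t Xnext res of
    ecp_body I (S `|` X)%fset t Xnext & it_s t < - ecp_eps I &
    ecp_outcome_from I (S `|` X)%fset Xnext res :
    ecp_outcome_from I S X res.

Definition ecp_outcome (R : realType) (d m : nat) (I : ecp_input R d m)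
    (res : ecp_result R d m) : Prop :=
  ecp_outcome_from I fset0 (ecp_X0 I) res.

(* Only the values of the weights [w] on [X] matter. *)

Definition weights_value (R : realType) (d m : nat) (I : ecp_input R d m)
    (X : {fset 'rV[R]_d}) (w : 'rV[R]_d -> R) : R :=
  \sum_(x <- X) w x * target I x.

Definition weights_feasible (R : realType) (d m : nat) (I : ecp_input R d m)
    (X : {fset 'rV[R]_d}) (w : 'rV[R]_d -> R) : Prop :=
  [/\ \sum_(x <- X) w x = 1,
      vle (pi_lo I) (\sum_(x <- X) w x *: payoff I x),
      vle (\sum_(x <- X) w x *: payoff I x) (pi_hi I) &
      forall x, x \in X -> 0 <= w x].

Definition weights_optimal (R : realType) (d m : nat) (I : ecp_input R d m)
    (X : {fset 'rV[R]_d}) (w : 'rV[R]_d -> R) : Prop :=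
  weights_feasible I X w /\
  forall w', weights_feasible I X w' ->
    weights_value I X w' <= weights_value I X w.

(* $\mathbb{R}^d$ with its Borel sigma-algebra. *)
Definition borel_rV (R : realType) (d : nat) :=
  g_sigma_algebraType (@open 'rV[R]_d).

(* Borel probability measures on [Omega I] are taken to be the Borel
   probability measures on $\mathbb{R}^d$ for which it has full measure. *)
Definition Qset (R : realType) (d m : nat) (I : ecp_input R d m) :
    set (probability (borel_rV R d) R) :=
  [set mu : probability (borel_rV R d) R | mu (Omega I) = 1%E /\
    forall j : 'I_m,
      ((pi_lo I 0 j)%:E <= \int[mu]_(x in Omega I) (payoff I x 0 j)%:E)%E /\
      (\int[mu]_(x in Omega I) (payoff I x 0 j)%:E <= (pi_hi I 0 j)%:E)%E].

Definition integral_target (R : realType) (d m : nat) (I : ecp_input R d m)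
    (mu : probability (borel_rV R d) R) : \bar R :=
  (\int[mu]_(x in Omega I) (target I x)%:E)%E.

Definition eps_optimal (R : realType) (d m : nat) (I : ecp_input R d m)
    (mu : probability (borel_rV R d) R) : Prop :=
  Qset I mu /\
  (ereal_sup [set integral_target I nu | nu in Qset I] - (ecp_eps I)%:E
     <= integral_target I mu)%E.

Definition is_weighted_dirac (R : realType) (d : nat) (X : {fset 'rV[R]_d})
    (w : 'rV[R]_d -> R) (mu : probability (borel_rV R d) R) : Prop :=
  forall A : set (borel_rV R d), measurable A ->
    mu A = (\sum_(x <- X) (w x)%:E * @dirac _ (borel_rV R d) x R A)%E.

(* Main.v *)
Require Import Defs.
From HB Require Import structures.
From mathcomp Require Import all_boot all_order all_algebra.
From mathcomp Require Import finmap.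
From mathcomp Require Import all_classical all_reals all_analysis.
From mathcomp Require Import measurable_realfun ring lra.

Set Implicit Arguments.
Unset Strict Implicit.
Unset Printing Implicit Defensive.

Import Order.TTheory GRing.Theory Num.Theory.
Import numFieldNormedType.Exports.

Local Open Scope classical_set_scope.
Local Open Scope ring_scope.

(** Why the theorem is true.

    Finiteness. Let [z] minimize the slack over the box in some pass, and call
    two points of the box equivalent when the same affine pieces attain each of
    the maxima in [target] and [payoff] and the same bounds of the box are
    active. If [x] is equivalent to [z], then the segment from [x] to [z] can be
    prolonged a little beyond [z] inside the box, and every slack function is
    affine on the prolonged segment, whatever the portfolio. Since the slack is
    minimal at [z], it is constant there: it takes the same value at [x] and at
    [z] ([slack_constant_on_cells]). In a pass with [it_s] negative the
    minimizer [z] violates its own inequality, so it cannot be equivalent to a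
    point whose inequality is already in the system; hence each such pass meets
    an equivalence class that no earlier one met, and there are finitely many
    classes ([ecp_terminates_from_Omega]). A pass can always be carried out,
    because the linear program is feasible and its objective is bounded below
    ([lp_minimum_attained]), and because a slack function is continuous on a
    compact box ([slack_minimum]).

    The answer is never that the problem is unbounded. Adding the superhedge
    found for [target] to the one given for [- target] yields a portfolio with a
    nonnegative payoff, whose price is nonnegative by the no-arbitrage
    condition; with the subadditivity of [price] this reads
    [phi_low I <= ecp_UB I t] ([ecp_UB_ge_phi_low]).

    Optimality. The weights program is the dual of the linear program of the
    last pass without its lower bound [phi_low I - ecp_tau I] on the objective.
    When [ecp_eps I < ecp_tau I], at the end
    [ecp_LB >= ecp_UB - ecp_eps >= phi_low I - ecp_eps > phi_low I - ecp_tau I],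
    so that this bound is inactive and has multiplier 0, and linear
    programming duality gives feasible weights of value [ecp_LB]
    ([weights_strong_duality]). Every measure in the set Q integrates [target]
    to at most [ecp_UB], because the shifted portfolio of the last pass
    superhedges [target] ([Qset_integral_le]). Lower and upper bound differ by
    at most [ecp_eps].

    Linear programming duality itself rests on Farkas' lemma, obtained here by
    Fourier-Motzkin elimination ([farkas_alternative]). *)

(** * Farkas' lemma by Fourier-Motzkin elimination *)

Lemma separate_finite (R : realFieldType) (T : finType) (P Q : pred T)
    (L : T -> R) :
  (forall i j, P i -> Q j -> L i <= L j) ->
  exists t, (forall i, P i -> L i <= t) /\ (forall j, Q j -> t <= L j).
Proof.
move=> PQ; have [i0 Pi0|noP] := pickP P.
  case: (arg_maxP L Pi0) => i Pi maxi.
  by exists (L i); split=> [j /maxi|j Qj] //; exact: PQ.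
have [j0 Qj0|noQ] := pickP Q.
  case: (arg_minP L Qj0) => j Qj minj.
  by exists (L j); split=> [i|k /minj] //; rewrite noP.
by exists 0; split=> i; rewrite ?noP ?noQ.
Qed.

(** [fm_left a b] and [fm_right a b] are the nonnegative multipliers that
    Fourier-Motzkin elimination puts on two rows in which the variable to
    eliminate has the coefficients [a] and [b]. They keep the first row when
    [a = 0], cancel the variable when [b < 0 < a], and yield the trivial row
    0 >= 0 otherwise, so that one family indexed by all the pairs of rows covers
    all cases. *)
Definition fm_left (R : realFieldType) (a b : R) : R :=
  if a == 0 then 1 else if (0 < a) && (b < 0) then - b else 0.

Definition fm_right (R : realFieldType) (a b : R) : R :=
  if (0 < a) && (b < 0) then a else 0.

Lemma fm_left_ge0 (R : realFieldType) (a b : R) : 0 <= fm_left a b.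
Proof.
rewrite /fm_left; case: ifP => // _; case: ifP => // /andP[_ b0].
by rewrite oppr_ge0 ltW.
Qed.

Lemma fm_right_ge0 (R : realFieldType) (a b : R) : 0 <= fm_right a b.
Proof. by rewrite /fm_right; case: ifP => // /andP[a0 _]; lra. Qed.

Lemma fm_cancel (R : realFieldType) (a b : R) :
  fm_left a b * a + fm_right a b * b = 0.
Proof.
rewrite /fm_left /fm_right; case: eqP => [->|_]; first by rewrite ltxx /=; ring.
by case: ifP => _; ring.
Qed.

(** Fourier-Motzkin elimination, one variable of [vs] at a time. A solution of
    the reduced system extends to the eliminated variable because the lower
    bounds that it receives lie below the upper bounds; a certificate for the
    reduced system, whose rows are nonnegative combinations of the original
    ones, is also a certificate for the original system. *)
Theorem farkas_alternative (R : realFieldType) (V : eqType) (vs : seq V)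
    (T : finType) (a : T -> V -> R) (b : T -> R) :
  uniq vs ->
  (exists x : V -> R, forall i, b i <= \sum_(v <- vs) a i v * x v) \/
  (exists l : T -> R, [/\ forall i, 0 <= l i,
     forall v, v \in vs -> \sum_i l i * a i v = 0 & 0 < \sum_i l i * b i]).
Proof.
elim: vs => [|v vs IH] in T a b *.
  move=> _; have [i bi|nob] := pickP (fun i => 0 < b i).
    right; exists (fun j => (j == i)%:R); split=> //.
    rewrite (bigD1 i) //= eqxx mul1r big1 ?addr0 // => j /negPf ->.
    by rewrite mul0r.
  by left; exists (fun=> 0) => i; rewrite big_nil leNgt nob.
rewrite cons_uniq => /andP[vNvs uvs].
pose p i j := fm_left (a i v) (a j v).
pose q i j := fm_right (a i v) (a j v).
pose a' (e : T * T) w := p e.1 e.2 * a e.1 w + q e.1 e.2 * a e.2 w.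
pose b' (e : T * T) := p e.1 e.2 * b e.1 + q e.1 e.2 * b e.2.
have [[x xP]|[l [l0 la lb]]] := IH _ a' b' uvs.
  pose S i := \sum_(w <- vs) a i w * x w.
  have redP i j : p i j * b i + q i j * b j <= p i j * S i + q i j * S j.
    have := xP (i, j); rewrite /b' /a' /= => /le_trans -> //.
    rewrite /S !mulr_sumr -big_split /= le_eqVlt; apply/orP; left; apply/eqP.
    by apply: eq_bigr => w _; ring.
  (* [L i] is the bound on the eliminated variable given by row [i]. *)
  pose L i := (b i - S i) / a i v.
  have [i j ai aj|t [tP tQ]] := @separate_finite R T
    (fun i => 0 < a i v) (fun j => a j v < 0) L.
    have := redP i j; rewrite /p /q /fm_left /fm_right ai aj /= gt_eqF //.
    rewrite /L ler_pdivrMr // mulrAC ler_ndivlMr //; nra.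
  left; exists (fun w => if w == v then t else x w) => i.
  rewrite big_cons eqxx (_ : \sum_(w <- vs) _ = S i); last first.
    rewrite /S big_seq [RHS]big_seq; apply: eq_bigr => w wvs.
    by case: eqP wvs vNvs => // -> ->.
  have [ai|ai|ai] := ltgtP (a i v) 0.
  - have := tQ i ai; rewrite /L ler_ndivlMr //; lra.
  - have := tP i ai; rewrite /L ler_pdivrMr //; lra.
  - have := redP i i; rewrite /p /q /fm_left /fm_right ai eqxx ltxx /=; lra.
right; pose l' i := \sum_(e : T * T)
  l e * (p e.1 e.2 * (e.1 == i)%:R + q e.1 e.2 * (e.2 == i)%:R).
have l'E (f : T -> R) : \sum_i l' i * f i =
    \sum_(e : T * T) l e * (p e.1 e.2 * f e.1 + q e.1 e.2 * f e.2).
  under eq_bigr do rewrite /l' mulr_suml.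
  rewrite exchange_big; apply: eq_bigr => e _ /=.
  have pick k : \sum_i (k == i)%:R * f i = f k.
    rewrite (bigD1 k) //= eqxx mul1r big1 ?addr0 // => i /negPf.
    by rewrite eq_sym => ->; rewrite mul0r.
  rewrite -(pick e.1) -(pick e.2) !mulr_sumr -big_split /= mulr_sumr.
  by apply: eq_bigr => i _; ring.
exists l'; split=> [i|w|].
- apply: sumr_ge0 => e _; rewrite mulr_ge0 // addr_ge0 // mulr_ge0 ?ler0n //.
    exact: fm_left_ge0.
  exact: fm_right_ge0.
- rewrite l'E inE => /predU1P[->|/la //].
  by rewrite big1 // => e _; rewrite /p /q fm_cancel mulr0.
- by rewrite l'E.
Qed.

(** * Linear programming over a finite type of variables *)

Lemma sum_option (R : nmodType) (T : finType) (F : option T -> R) :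
  \sum_i F i = F None + \sum_i F (Some i).
Proof.
rewrite (bigD1 None) //=; congr (_ + _).
rewrite (reindex_omap Some id) => [|[i|]//] /=.
by apply: eq_bigl => i; rewrite eqxx.
Qed.

Definition lin (R : realType) (V : finType) (c x : V -> R) : R :=
  \sum_v c v * x v.

Definition polyhedron (R : realType) (V T : finType) (a : T -> V -> R)
  (b : T -> R) : set (V -> R) := [set x | forall i, b i <= lin (a i) x].

Lemma lin_comb (R : realType) (V T : finType) (a : T -> V -> R) (l : T -> R)
    (x : V -> R) :
  lin (fun v => \sum_i l i * a i v) x = \sum_i l i * lin (a i) x.
Proof.
rewrite /lin; under eq_bigr do rewrite mulr_suml.
rewrite exchange_big; apply: eq_bigr => i _ /=; rewrite mulr_sumr.
by apply: eq_bigr => v _; rewrite mulrA.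
Qed.

Lemma linD (R : realType) (V : finType) (c x y : V -> R) (s t : R) :
  lin c (fun v => s * x v + t * y v) = s * lin c x + t * lin c y.
Proof.
rewrite /lin !mulr_sumr -big_split; apply: eq_bigr => v _ /=; ring.
Qed.

Lemma weak_duality (R : realType) (V T : finType) (a : T -> V -> R)
    (b : T -> R) (l : T -> R) (x : V -> R) :
  (forall i, 0 <= l i) -> polyhedron a b x ->
  \sum_i l i * b i <= lin (fun v => \sum_i l i * a i v) x.
Proof.
by move=> l0 ax; rewrite lin_comb; apply: ler_sum => i _; rewrite ler_wpM2l.
Qed.

(** Adding the row [lin o x <= p], where [p] is the infimum of the objective,
    keeps the system solvable: a certificate of infeasibility would either
    refute the original system or bound the objective below by a number larger
    than [p]. *)
Theorem lp_minimum_attained (R : realType) (V T : finType) (a : T -> V -> R)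
    (b : T -> R) (o : V -> R) (B : R) :
  polyhedron a b !=set0 -> (forall x, polyhedron a b x -> B <= lin o x) ->
  exists2 x, polyhedron a b x &
    forall y, polyhedron a b y -> lin o x <= lin o y.
Proof.
move=> [z az] oB; set p := inf (lin o @` polyhedron a b).
have p_le y : polyhedron a b y -> p <= lin o y.
  by move=> ay; apply: ge_inf; [exists B => _ [x /oB ? <-]|exists y].
pose a' (i : option T) := if i is Some j then a j else fun v => - o v.
pose b' (i : option T) := if i is Some j then b j else - p.
have linN x : lin (fun v => - o v) x = - lin o x.
  by rewrite /lin -sumrN; apply: eq_bigr => v _; rewrite mulNr.
case: (farkas_alternative a' b' (enum_uniq V)) => [[x xP]|[l [l0 la lb]]].
  exists x => [i|y /p_le]; first by have := xP (Some i); rewrite /= big_enum.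
  apply: le_trans; have := xP None; rewrite /= big_enum /=.
  by rewrite [X in _ <= X]linN lerN2.
have low y : polyhedron a b y ->
    \sum_i l (Some i) * b i <= l None * lin o y.
  move=> /(@weak_duality _ _ _ _ _ (l \o Some) _ (fun i => l0 (Some i))).
  move=> /le_trans; apply; rewrite /lin mulr_sumr le_eqVlt; apply/orP; left.
  apply/eqP/eq_bigr => v _; have := la v (mem_enum _ _).
  by rewrite sum_option /= mulrN addrC => /subr0_eq ->; rewrite mulrA.
move: lb; rewrite sum_option /= mulrN addrC subr_gt0 => lb.
have [l0'|l_gt0] := eqVneq (l None) 0.
  by have := lt_le_trans lb (low z az); rewrite l0' !mul0r ltxx.
have {}l_gt0 : 0 < l None by rewrite lt0r l_gt0 l0.
have : (\sum_i l (Some i) * b i) / l None <= p.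
  apply: lb_le_inf; first by exists (lin o z), z.
  by move=> _ [y ay <-]; rewrite ler_pdivrMr // mulrC low.
by rewrite ler_pdivrMr // mulrC leNgt lb.
Qed.

(** Homogenization. With a further variable [s >= 0] that multiplies the right
    hand sides, the inequality [B * s - lin o x >= 1] cannot be met, since it
    would give points of the polyhedron with an objective below [B]. The
    multiplier of that row in the certificate of infeasibility is positive, and
    dividing by it yields the dual solution. *)
Theorem lp_duality (R : realType) (V T : finType) (a : T -> V -> R)
    (b : T -> R) (o : V -> R) (B : R) :
  polyhedron a b !=set0 -> (forall x, polyhedron a b x -> B <= lin o x) ->
  exists l : T -> R, [/\ forall i, 0 <= l i,
    forall v, \sum_i l i * a i v = o v & B <= \sum_i l i * b i].
Proof.
move=> [z az] oB.
pose a' (i : option (option T)) (v : option V) := match i, v with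
  | Some (Some j), Some w => a j w
  | Some (Some j), None => - b j
  | Some None, Some _ => 0
  | Some None, None => 1
  | None, Some w => - o w
  | None, None => B
  end.
pose b' (i : option (option T)) : R := if i is None then 1 else 0.
case: (farkas_alternative a' b' (enum_uniq {: option V}))
  => [[x xP]|[l [l0 la lb]]].
  pose x1 v := x (Some v); pose s := x None.
  have s0 : 0 <= s.
    have := xP (Some None); rewrite /= big_enum sum_option /= big1 => [|v _].
      by rewrite mul1r addr0.
    by rewrite mul0r.
  have ax i : b i * s <= lin (a i) x1.
    have := xP (Some (Some i)); rewrite /= big_enum sum_option /=.
    by rewrite mulNr addrC subr_ge0.
  have ox : lin o x1 + 1 <= B * s.
    have := xP None; rewrite /= big_enum sum_option /=.
    under eq_bigr do rewrite mulNr.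
    by rewrite sumrN -[X in _ - X]/(lin o x1) -/s lerBrDl addrC.
  (* Moving from [z] by [N] times the direction [x1] and rescaling lowers the
     objective below [B] as soon as [N] exceeds [lin o z - B]. *)
  pose N := lin o z - B + 1.
  have N1 : 1 <= N by have := oB z az; rewrite /N; lra.
  have D0 : 0 < 1 + N * s by rewrite ltr_pwDl // mulr_ge0 //; lra.
  have Dv : (1 + N * s)^-1 * (1 + N * s) = 1 by rewrite mulVf // gt_eqF.
  have Di : 0 < (1 + N * s)^-1 by rewrite invr_gt0.
  set D := (1 + N * s)^-1 in Dv Di.
  have /oB : polyhedron a b (fun v => D * z v + (D * N) * x1 v).
    move=> i; rewrite linD -(mul1r (b i)) -Dv.
    have := ax i; have := az i => /(ler_wpM2l (ltW Di)) azi.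
    have DN : 0 <= D * N by rewrite mulr_ge0 //; lra.
    move=> /(ler_wpM2l DN); lra.
  rewrite linD -(mul1r B) -{1}Dv => h.
  have {}h : (1 + N * s) * B <= lin o z + N * lin o x1.
    by rewrite -(ler_pM2l Di); lra.
  have /(ler_wpM2l (_ : 0 <= N)) : lin o x1 + 1 <= B * s by [].
  by move=> /(_ ltac:(lra)); rewrite /N in h *; lra.
move: lb; rewrite sum_option /= big1 => [|i _]; last by rewrite mulr0.
rewrite mulr1 addr0 => l_gt0.
exists (fun i => l (Some (Some i)) / l None); split=> [i|v|].
- by rewrite divr_ge0.
- have := la (Some v) (mem_enum _ _).
  rewrite !sum_option /= mulr0 add0r mulrN addrC => /subr0_eq lE.
  under eq_bigr do rewrite mulrAC.
  by rewrite -mulr_suml lE mulrAC divff ?mul1r ?gt_eqF.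
- have := la None (mem_enum _ _); rewrite !sum_option /= mulr1.
  under eq_bigr do rewrite mulrN.
  rewrite sumrN; under [X in _ -> _ <= X]eq_bigr do rewrite mulrAC.
  rewrite -mulr_suml ler_pdivlMr //; have := l0 (Some None); lra.
Qed.

(** * The linear program of the algorithm and its dual *)

Lemma dotvDl (R : realType) n (u v w : 'rV[R]_n) :
  dotv (u + v) w = dotv u w + dotv v w.
Proof.
by rewrite /dotv -big_split; apply: eq_bigr => i _; rewrite mxE mulrDl.
Qed.

Lemma dotvBl (R : realType) n (u v w : 'rV[R]_n) :
  dotv (u - v) w = dotv u w - dotv v w.
Proof.
by rewrite /dotv -sumrB; apply: eq_bigr => i _; rewrite !mxE mulrBl.
Qed.

Section ecp_lp.
Context (R : realType) (d m : nat) (I : ecp_input R d m).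
Implicit Type S : {fset 'rV[R]_d}.

(** The variables of the linear program: [None] is [c], and the two copies of
    ['I_m] are the coordinates of [yp] and [ym]. *)
Definition lp_var := option ('I_m + 'I_m).

Definition lp_cost (v : lp_var) : R :=
  match v with
  | None => 1
  | Some (inl j) => pi_hi I 0 j
  | Some (inr j) => - pi_lo I 0 j
  end.

(** The row [None] is the lower bound on the objective, the next ones are the
    sign constraints, and the last ones are those of the points of [S]. *)
Definition lp_row S (i : option (('I_m + 'I_m) + S)) (v : lp_var) : R :=
  match i with
  | None => lp_cost v
  | Some (inl k) => (Some k == v)%:R
  | Some (inr x) =>
      match v with
      | None => 1
      | Some (inl j) => payoff I (val x) 0 j
      | Some (inr j) => - payoff I (val x) 0 j
      end
  end.

Definition lp_rhs S (i : option (('I_m + 'I_m) + S)) : R :=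
  match i with
  | None => phi_low I - ecp_tau I
  | Some (inl k) => 0
  | Some (inr x) => target I (val x)
  end.

Definition lp_point (c : R) (yp ym : 'rV[R]_m) (v : lp_var) : R :=
  match v with
  | None => c
  | Some (inl j) => yp 0 j
  | Some (inr j) => ym 0 j
  end.

Lemma lp_point_surj (z : lp_var -> R) :
  exists c yp ym, z = lp_point c yp ym.
Proof.
exists (z None), (\row_j z (Some (inl j))), (\row_j z (Some (inr j))).
by apply/funext => -[[j|j]|] //=; rewrite mxE.
Qed.

Lemma lin_lp_cost c yp ym :
  lin lp_cost (lp_point c yp ym) = lp_obj I c yp ym.
Proof.
rewrite /lin sum_option /= mul1r big_sumType /= /lp_obj -addrA; congr (_ + _).
congr (_ + _); first by apply: eq_bigr => j _; rewrite mulrC.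
by rewrite /dotv -sumrN; apply: eq_bigr => j _; rewrite mulNr mulrC.
Qed.

Lemma lin_lp_point_row S (x : S) c yp ym :
  lin (lp_row (Some (inr x))) (lp_point c yp ym) =
  c + dotv (yp - ym) (payoff I (val x)).
Proof.
rewrite /lin sum_option /= mul1r big_sumType /= dotvBl; congr (_ + (_ + _)).
  by apply: eq_bigr => j _; rewrite mulrC.
by rewrite /dotv -sumrN; apply: eq_bigr => j _; rewrite mulNr mulrC.
Qed.

Lemma lin_lp_sign_row S (k : 'I_m + 'I_m) (z : lp_var -> R) :
  lin (@lp_row S (Some (inl k))) z = z (Some k).
Proof.
rewrite /lin (bigD1 (Some k)) //= eqxx mul1r big1 ?addr0 // => v vk.
by rewrite eq_sym (negPf vk) mul0r.
Qed.

Lemma polyhedron_lp_feasible S c yp ym :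
  polyhedron (@lp_row S) (@lp_rhs S) (lp_point c yp ym) <->
  lp_feasible I S c yp ym.
Proof.
split=> [h|[yp0 ym0 bnd pts] [[k|x]|]].
- split=> [j|j||x xS].
  + by have := h (Some (inl (inl j))); rewrite lin_lp_sign_row mxE.
  + by have := h (Some (inl (inr j))); rewrite lin_lp_sign_row mxE.
  + by have := h None; rewrite -lin_lp_cost.
  + by have := h (Some (inr [` xS]%fset)); rewrite lin_lp_point_row.
- rewrite lin_lp_sign_row.
  by case: k => j /=; [have := yp0 j|have := ym0 j]; rewrite mxE.
- by rewrite lin_lp_point_row; exact/pts/valP.
- by rewrite -lin_lp_cost in bnd.
Qed.

Lemma lp_minimizer_exists S c yp ym :
  lp_feasible I S c yp ym -> exists c' yp' ym', lp_minimizer I S c' yp' ym'.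
Proof.
move=> /polyhedron_lp_feasible feas.
have [z|z] := lp_minimum_attained (b := @lp_rhs S) (o := lp_cost)
  (B := phi_low I - ecp_tau I) (ex_intro _ _ feas).
  by move=> h; exact: (h None).
have [c' [yp' [ym' ->]]] := lp_point_surj z.
move=> /polyhedron_lp_feasible feas' min; exists c', yp', ym'.
by split=> // c2 y2 z2 /polyhedron_lp_feasible /min; rewrite !lin_lp_cost.
Qed.

Lemma weights_weak_duality S c yp ym w :
  lp_feasible I S c yp ym -> weights_feasible I S w ->
  weights_value I S w <= lp_obj I c yp ym.
Proof.
move=> [yp0 ym0 _ pts] [w1 lo hi w0].
have sumE j : (\sum_(x <- S) w x *: payoff I x) 0 j =
    \sum_(x <- S) w x * payoff I x 0 j.
  by rewrite summxE; apply: eq_bigr => x _; rewrite mxE.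
apply: (@le_trans _ _ (\sum_(x <- S) w x * (c + dotv (yp - ym) (payoff I x)))).
  rewrite /weights_value big_seq [leRHS]big_seq; apply: ler_sum => x xS.
  by rewrite ler_wpM2l ?w0 ?pts.
under eq_bigr do rewrite mulrDr.
rewrite big_split /= -mulr_suml w1 mul1r /lp_obj -addrA lerD2l.
rewrite (_ : \sum_(x <- S) _ =
    dotv (yp - ym) (\sum_(x <- S) w x *: payoff I x)); last first.
  rewrite /dotv; under eq_bigr do rewrite mulr_sumr.
  rewrite exchange_big; apply: eq_bigr => j _ /=.
  by rewrite sumE mulr_sumr; apply: eq_bigr => x _; ring.
rewrite dotvBl lerB //; apply: ler_sum => j _.
  by rewrite ler_wpM2l //; have := yp0 j; rewrite mxE.
by rewrite ler_wpM2l //; have := ym0 j; rewrite mxE.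
Qed.

(** The dual of the linear program has one multiplier per point of [S], the
    weights; one per sign constraint, which by being nonnegative turns an
    equation for the weights into an inequality on the prices; and one for the
    bound row, which vanishes when that row is not tight at the minimizer. *)
Lemma weights_strong_duality S c yp ym :
  lp_minimizer I S c yp ym -> phi_low I - ecp_tau I < lp_obj I c yp ym ->
  exists2 w, weights_feasible I S w & lp_obj I c yp ym <= weights_value I S w.
Proof.
move=> [/polyhedron_lp_feasible feas min] slackB.
set B := phi_low I - ecp_tau I in slackB.
have [z|l [l0 la lb]] := lp_duality (b := @lp_rhs S) (o := lp_cost)
  (B := lp_obj I c yp ym) (ex_intro _ _ feas).
  have [c' [yp' [ym' ->]]] := lp_point_surj z.
  by move=> /polyhedron_lp_feasible /min; rewrite lin_lp_cost.
(* Weak duality for the rows other than the bound row gives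
   [LB - l None * B <= (1 - l None) * LB], that is [l None * (LB - B) <= 0]. *)
have lNone : l None = 0.
  pose a' := @lp_row S \o Some.
  have /(@weak_duality _ _ _ _ _ (l \o Some) _ (fun i => l0 (Some i))) :
      polyhedron a' (@lp_rhs S \o Some) (lp_point c yp ym).
    by move=> i; exact: (feas (Some i)).
  rewrite /a' /= => wk; have {}wk : lp_obj I c yp ym - l None * B <=
      (1 - l None) * lp_obj I c yp ym.
    rewrite lerBlDl; apply: le_trans lb _; rewrite sum_option lerD2l.
    apply: le_trans wk _; rewrite -lin_lp_cost [in leRHS]/lin mulr_sumr.
    rewrite le_eqVlt; apply/orP; left; apply/eqP/eq_bigr => v _.
    by have := la v; rewrite sum_option /=; nra.
  have := l0 None; rewrite le_eqVlt => /orP[/eqP //|lN]; nra.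
have lE v : \sum_k l (Some (inl k)) * (Some k == v)%:R +
    \sum_(x : S) l (Some (inr x)) * lp_row (Some (inr x)) v = lp_cost v.
  by have := la v; rewrite sum_option lNone mul0r add0r big_sumType.
pose w x := if insub x is Some s then l (Some (inr (s : S))) else 0.
have wval (s : S) : w (val s) = l (Some (inr s)) by rewrite /w valK.
have sumw (F : 'rV[R]_d -> R) :
    \sum_(x <- S) w x * F x = \sum_(s : S) l (Some (inr s)) * F (val s).
  by rewrite big_seq_fsetE; apply: eq_bigr => s _; rewrite -wval.
have pickk k : \sum_k' l (Some (inl k')) * (Some k' == Some k :> lp_var)%:R =
    l (Some (inl k)).
  rewrite (bigD1 k) //= eqxx mulr1 big1 ?addr0 // => k' k'k.
  by rewrite (inj_eq Some_inj) (negPf k'k) mulr0.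
have wpay j : (\sum_(x <- S) w x *: payoff I x) 0 j =
    \sum_(s : S) l (Some (inr s)) * payoff I (val s) 0 j.
  rewrite summxE -(sumw (fun x => payoff I x 0 j)).
  by apply: eq_bigr => x _; rewrite mxE.
exists w.
  split=> [|j|j|x xS].
  - have := lE None; rewrite big1 ?add0r => [|k _]; last by rewrite mulr0.
    have := sumw (fun=> 1); under eq_bigr do rewrite mulr1.
    by move=> -> /=.
  - have := lE (Some (inr j)); rewrite pickk wpay /=.
    under [X in _ + X]eq_bigr do rewrite mulrN.
    by rewrite sumrN; have := l0 (Some (inl (inr j))); lra.
  - have := lE (Some (inl j)); rewrite pickk wpay /=.
    by have := l0 (Some (inl (inl j))); lra.
  - by rewrite -[x]/(val [` xS]%fset) wval.
rewrite /weights_value (sumw (target I)); apply: le_trans lb _.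
rewrite sum_option lNone mul0r add0r big_sumType /= big1 ?add0r // => k _.
by rewrite mulr0.
Qed.

End ecp_lp.

(** * Continuous piecewise affine functions on cells *)

Lemma dotvDr (R : realType) n (u v w : 'rV[R]_n) :
  dotv u (v + w) = dotv u v + dotv u w.
Proof.
by rewrite /dotv -big_split; apply: eq_bigr => i _; rewrite mxE mulrDr.
Qed.

Lemma dotvBr (R : realType) n (u v w : 'rV[R]_n) :
  dotv u (v - w) = dotv u v - dotv u w.
Proof.
by rewrite /dotv -sumrB; apply: eq_bigr => i _; rewrite !mxE mulrBr.
Qed.

Lemma dotvZr (R : realType) n (u v : 'rV[R]_n) t :
  dotv u (t *: v) = t * dotv u v.
Proof.
by rewrite /dotv mulr_sumr; apply: eq_bigr => i _; rewrite mxE mulrCA.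
Qed.

Lemma near_affine_lt (R : realType) (a b A B : R) :
  a < b -> \forall t \near 0^'+, a + t * A < b + t * B.
Proof.
move=> ab; near=> t.
have t0 : 0 < t by near: t; exact: nbhs_right_gt.
have AB : A - B <= `|A - B| by exact: ler_norm.
have AB0 : 0 < `|A - B| + 1 by rewrite ltr_wpDl.
have : t < (b - a) / (`|A - B| + 1).
  by near: t; apply: nbhs_right_lt; rewrite divr_gt0 ?subr_gt0.
by rewrite ltr_pdivlMr // => h; nra.
Unshelve. all: by end_near. Qed.

Lemma bigmax_ge (R : realType) n (F : nat -> R) (i : 'I_n.+1) :
  F i <= \big[Num.max/F 0%N]_(j < n.+1) F j.
Proof. exact: le_bigmax. Qed.

Lemma bigmax_attained (R : realType) n (F : nat -> R) :
  exists i : 'I_n.+1, \big[Num.max/F 0%N]_(j < n.+1) F j = F i.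
Proof.
elim/big_ind: _ => [|_ _ [i ->] [j ->]|i _]; [by exists ord0| |by exists i].
by case: (leP (F i) (F j)) => _; [exists j|exists i].
Qed.

Section cells.
Context (R : realType) (d : nat) (D : set 'rV[R]_d).

Definition beyond (x z : 'rV[R]_d) (t : R) : 'rV[R]_d := z + t *: (z - x).

(** The tests [q] cut [D] into finitely many cells, and [h] extrapolates
    affinely, for a short while, along any line from one point of a cell through
    another point of the same cell. Tests may ask for
    equalities, so that cells can be relative interiors of faces of a polyhedral
    complex and not only full dimensional regions: a minimizer may well lie on a
    face of low dimension. *)
Definition affine_on_cells (h : 'rV[R]_d -> R) (T : finType)
    (q : T -> 'rV[R]_d -> bool) : Prop :=
  forall x z, D x -> D z -> (forall i, q i x = q i z) ->
    \forall t \near 0^'+, D (beyond x z t) ->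
      h (beyond x z t) = h z + t * (h z - h x).

(** The tests tell which affine pieces attain each maximum. Pieces that are
    active at [x] and [z] coincide on the whole line through them, and the
    others stay strictly below for a while beyond [z]. *)
Lemma cpwa_affine_on_cells h : cpwa_on D h ->
  exists (T : finType) (q : T -> 'rV[R]_d -> bool), affine_on_cells h q.
Proof.
move=> [K [n [a [b [xi [_ hE]]]]]].
pose l k i x := dotv (a k i) x + b k i.
pose M k x := \big[Num.max/l k 0%N x]_(i < (n k).+1) l k i x.
exists {k : 'I_K & 'I_(n k).+1}, (fun u x =>
  l (tag u) (tagged u : 'I_(n (tag u)).+1) x == M (tag u) x).
move=> x z Dx Dz xz.
have lE k i t : l k i (beyond x z t) = l k i z + t * (l k i z - l k i x).
  by rewrite /l /beyond dotvDr dotvZr dotvBr; ring.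
have Mray k : \forall t \near 0^'+,
    M k (beyond x z t) = M k z + t * (M k z - M k x).
  have tie i : (l k (i : 'I_(n k).+1) x == M k x) = (l k i z == M k z).
    exact: (xz (Tagged (fun k => 'I_(n k).+1) i)).
  have [i0 i0z] := bigmax_attained (n k) (fun i => l k i z).
  rewrite -/(M k z) in i0z.
  have i0x : M k x = l k i0 x by apply/esym/eqP; rewrite tie i0z.
  have : \forall t \near 0^'+, forall i : 'I_(n k).+1,
      l k i (beyond x z t) <= l k i0 (beyond x z t).
    apply: filter_forall => i; have [iz|iz] := eqVneq (l k i z) (M k z).
      have /eqP ix : l k i x == M k x by rewrite tie iz.
      by apply: nearW => t; rewrite !lE iz ix i0z i0x.
    have : l k i z < l k i0 z.
      rewrite -i0z lt_neqAle iz /=.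
      exact: (@bigmax_ge R _ (fun i => l k i z)).
    move=> /(@near_affine_lt _ _ _ (l k i z - l k i x) (l k i0 z - l k i0 x)).
    by apply: filterS => t; rewrite !lE => /ltW.
  apply: filterS => t max_i0; rewrite i0z i0x -lE.
  apply/eqP; rewrite eq_le; apply/andP; split.
    have [j jE] := bigmax_attained (n k) (fun i => l k i (beyond x z t)).
    by rewrite [M _ _]jE; exact: max_i0.
  exact: (@bigmax_ge R _ (fun i => l k i (beyond x z t))).
have : \forall t \near 0^'+, forall k,
    M k (beyond x z t) = M k z + t * (M k z - M k x) by exact: filter_forall.
apply: filterS => t Mt Dt.
rewrite !hE // -sumrB mulr_sumr -big_split; apply: eq_bigr => k _ /=.
by have := Mt k; rewrite /M /l => ->; ring.
Qed.

Lemma cpwa_continuous h : cpwa_on D h ->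
  exists2 h', continuous (h' : 'rV[R]_d -> R) & {in D, h =1 h'}.
Proof.
move=> [K [n [a [b [xi [_ hE]]]]]].
pose l k i x := dotv (a k i) x + b k i.
have sumc (J : finType) (F : J -> 'rV[R]_d -> R) :
    (forall j, continuous (F j)) -> continuous (fun x => \sum_j F j x).
  move=> cF; apply: continuous_big => [|j _]; last exact: cF.
  exact: add_continuous.
have maxc (J : finType) (e : 'rV[R]_d -> R) (F : J -> 'rV[R]_d -> R) s :
    continuous e -> (forall j, continuous (F j)) ->
    continuous (fun x => \big[Num.max/e x]_(j <- s) F j x).
  move=> ce cF; elim: s => [|j s IH].
    by rewrite (_ : (fun x => _) = e) //; apply/funext => x; rewrite big_nil.
  rewrite (_ : (fun x => _) =
      F j \max (fun x => \big[Num.max/e x]_(j <- s) F j x)).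
    by move=> x; exact: (continuous_max (cF j x) (IH x)).
  by apply/funext => x; rewrite big_cons.
have lc k i : continuous (l k i : 'rV[R]_d -> R).
  move=> x; apply: (@continuousD _ _ _ (dotv (a k i) : _ -> R) (fun=> b k i)).
    apply: sumc => j {}x; apply: (@continuousM _ _ (fun=> a k i 0 j)).
      exact: cst_continuous.
    exact: coord_continuous.
  exact: cst_continuous.
exists (fun x => \sum_(k < K) xi k *
  \big[Num.max/l k 0%N x]_(i < (n k).+1) l k i x); last first.
  by move=> x; rewrite inE => /hE.
apply: sumc => k x; apply: (@continuousM _ _ (fun=> xi k)).
  exact: cst_continuous.
exact: maxc.
Qed.

End cells.

(** * Slack functions on a box *)

Lemma box_compact (R : realType) d (b : 'rV[R]_d) : compact (box b).
Proof.
rewrite (_ : box b = [set v | forall i, `[0, b 0 i]%classic (v ord0 i)]).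
  apply: (@rV_compact R d (fun i => `[0, b 0 i]%classic)) => i.
  exact: segment_compact.
apply/seteqP; split=> v /= => [[v0 vb] i|vi].
  by rewrite in_itv /= vb andbT; have := v0 i; rewrite mxE.
by split=> i; have := vi i; rewrite in_itv /= => /andP[]; rewrite ?mxE.
Qed.

Lemma box_zero (R : realType) d (b : 'rV[R]_d) : vlt 0 b -> box b 0.
Proof. by move=> b0; split=> i //; exact/ltW/b0. Qed.

(** A bound that is active at both points is active on the line through them, so
    that the prolonged segment stays in the box. *)
Lemma box_cells (R : realType) d (b : 'rV[R]_d) :
  exists (T : finType) (q : T -> 'rV[R]_d -> bool), forall x z,
    box b x -> box b z -> (forall i, q i x = q i z) ->
    \forall t \near 0^'+, box b (beyond x z t).
Proof.
exists ('I_d + 'I_d)%type, (fun i x => match i with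
  inl i => x 0 i == 0 | inr i => x 0 i == b 0 i end).
move=> x z [x0 xb] [z0 zb] xz.
have lo : \forall t \near 0^'+, forall i, 0 <= beyond x z t 0 i.
  apply: filter_forall => i; have := xz (inl i) => /=.
  have := z0 i; rewrite mxE le_eqVlt => /predU1P[/esym zi0|zi0 _].
    rewrite zi0 eqxx => /eqP xi0; apply: nearW => t.
    by rewrite !mxE zi0 xi0 subrr mulr0 addr0.
  have := @near_affine_lt _ _ _ 0 (z 0 i - x 0 i) zi0.
  by apply: filterS => t; rewrite !mxE; lra.
have hi : \forall t \near 0^'+, forall i, beyond x z t 0 i <= b 0 i.
  apply: filter_forall => i; have := xz (inr i) => /=.
  have := zb i; rewrite le_eqVlt => /predU1P[zib|zib _].
    rewrite zib eqxx => /eqP xib; apply: nearW => t.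
    by rewrite !mxE zib xib subrr mulr0 addr0.
  have := @near_affine_lt _ _ _ (z 0 i - x 0 i) 0 zib.
  by apply: filterS => t; rewrite !mxE; lra.
by move: lo hi; apply: filterS2 => t lo hi; split=> i //; rewrite mxE.
Qed.

Section slack.
Context (R : realType) (d m : nat) (I : ecp_input R d m).
Hypothesis target_cpwa : cpwa_on (Omega I) (target I).
Hypothesis payoff_cpwa :
  forall j, cpwa_on (Omega I) (fun x => payoff I x 0 j).

(** At the prolonged point the slack is [slack z + t * (slack z - slack x)], and
    minimality at [z] of the slack bounds it below by [slack z]; hence
    [slack x <= slack z]. The tests do not depend on the portfolio [y]. *)
Lemma slack_constant_on_cells :
  exists (T : finType) (q : T -> 'rV[R]_d -> bool), forall y x z,
    Omega I x -> Omega I z -> (forall i, q i x = q i z) ->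
    (forall u, Omega I u -> slack I y z <= slack I y u) ->
    slack I y x = slack I y z.
Proof.
have [Tb [qb boxP]] := box_cells (xbar I).
have [Tf [qf fP]] := cpwa_affine_on_cells target_cpwa.
have /choice[c gP] j : exists c : {T : finType & T -> 'rV[R]_d -> bool},
    affine_on_cells (Omega I) (fun x => payoff I x 0 j) (tagged c).
  have [T [q qP]] := cpwa_affine_on_cells (payoff_cpwa j).
  by exists (Tagged _ q).
pose Tg j : finType := tag (c j).
exists ((Tb + Tf) + {j : 'I_m & Tg j})%type, (fun i x => match i with
  inl (inl i) => qb i x | inl (inr i) => qf i x
| inr u => tagged (c (tag u)) (tagged u) x end).
move=> y x z Dx Dz xz zmin.
have near_box := boxP x z Dx Dz (fun i => xz (inl (inl i))).
have near_f := fP x z Dx Dz (fun i => xz (inl (inr i))).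
have near_g : \forall t \near 0^'+, forall j, Omega I (beyond x z t) ->
    payoff I (beyond x z t) 0 j =
    payoff I z 0 j + t * (payoff I z 0 j - payoff I x 0 j).
  apply: filter_forall => j.
  exact: (gP j x z Dx Dz (fun i => xz (inr (Tagged Tg i)))).
have [t [[[Dt /(_ Dt) ft] gt] t0]] : exists t : R,
    ((Omega I (beyond x z t) /\ (Omega I (beyond x z t) ->
      target I (beyond x z t) = target I z + t * (target I z - target I x))) /\
    (forall j, Omega I (beyond x z t) -> payoff I (beyond x z t) 0 j =
      payoff I z 0 j + t * (payoff I z 0 j - payoff I x 0 j))) /\ 0 < t.
  apply: (@filter_ex _ (0^'+ : set_system R)); apply: filterI.
    by apply: filterI => //; exact: filterI.
  exact: nbhs_right_gt.
have yt : dotv y (payoff I (beyond x z t)) = dotv y (payoff I z) +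
    t * (dotv y (payoff I z) - dotv y (payoff I x)).
  rewrite -dotvBr -dotvZr -dotvDr; congr dotv; apply/rowP => j.
  by rewrite gt // !mxE.
have := zmin _ Dt; have := zmin _ Dx; rewrite /slack ft yt => zx zt.
by apply/eqP; rewrite eq_le zx andbT; nra.
Qed.

Lemma slack_continuous y :
  exists2 h, continuous (h : 'rV[R]_d -> R) & {in Omega I, slack I y =1 h}.
Proof.
have [f cf fE] := cpwa_continuous target_cpwa.
have /choice[g gP] j : exists g : 'rV[R]_d -> R,
    continuous g /\ {in Omega I, (fun x => payoff I x 0 j) =1 g}.
  by have [g cg gE] := cpwa_continuous (payoff_cpwa j); exists g.
exists (fun x => \sum_j y 0 j * g j x - f x) => [x|x xD].
  apply: (@continuousB _ _ _ (fun x => \sum_j y 0 j * g j x)); last exact: cf.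
  apply: continuous_big => [|j _ {}x]; first exact: add_continuous.
  apply: (@continuousM _ _ (fun=> y 0 j)); first exact: cst_continuous.
  exact: (gP j).1.
rewrite /slack fE //; congr (_ - _); apply: eq_bigr => j _.
by rewrite -(gP j).2.
Qed.

Hypothesis xbar_gt0 : vlt 0 (xbar I).

Lemma slack_minimum y : exists v, is_minimum (Omega I) (slack I y) v.
Proof.
have [h ch hE] := slack_continuous y.
have [x xD xmin] : exists2 x, x \in Omega I &
    forall t, t \in Omega I -> h x <= h t.
  apply: compact_EVT_min; [by exists 0; exact: box_zero|exact: box_compact|].
  exact: continuous_subspaceT.
exists (slack I y x); split; first by exists x => //; exact: set_mem.
by move=> z /mem_set zD; rewrite !hE // xmin.
Qed.

End slack.

(** * Superhedging prices and the run of the algorithm *)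

(** The negative part of [y] is [posv (- y)]. *)
Definition posv (R : realType) m (y : 'rV[R]_m) : 'rV[R]_m :=
  \row_j Num.max (y 0 j) 0.

Lemma posv_ge0 (R : realType) m (y : 'rV[R]_m) : vle 0 (posv y).
Proof. by move=> j; rewrite !mxE le_max lexx orbT. Qed.

Lemma posvB (R : realType) m (y : 'rV[R]_m) : posv y - posv (- y) = y.
Proof.
apply/rowP => j; rewrite !mxE.
by case: (leP (y 0 j) 0) => ?; case: (leP (- y 0 j) 0) => ?; lra.
Qed.

Section algorithm.
Context (R : realType) (d m : nat) (I : ecp_input R d m).

Lemma price_posv y :
  price I y = dotv (posv y) (pi_hi I) - dotv (posv (- y)) (pi_lo I).
Proof.
by rewrite /price /dotv -sumrB; apply: eq_bigr => j _; rewrite !mxE.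
Qed.

Hypothesis pi_le : vle (pi_lo I) (pi_hi I).

(** Splitting a position into a long and a short part other than its positive
    and negative parts can only cost more, as one buys high and sells low. *)
Lemma price_le yp ym : vle 0 yp -> vle 0 ym ->
  price I (yp - ym) <= dotv yp (pi_hi I) - dotv ym (pi_lo I).
Proof.
move=> yp0 ym0; rewrite /price /dotv -sumrB; apply: ler_sum => j _.
have := yp0 j; have := ym0 j; have := pi_le j; rewrite !mxE => lohi m0 p0.
have [uv|vu] := leP (yp 0 j) (ym 0 j).
  rewrite max_r ?max_l ?oppr_ge0 ?subr_le0 //.
  by rewrite mul0r sub0r mulNr opprK mulrBl lerD2r ler_wpM2l.
rewrite max_l ?max_r ?oppr_le0 ?subr_ge0 ?(ltW vu) //.
by rewrite mul0r subr0 mulrBl lerD2l lerN2 ler_wpM2l.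
Qed.

Lemma priceD y z : price I (y + z) <= price I y + price I z.
Proof.
have pos u v : vle 0 (posv u + posv v :> 'rV[R]_m).
  by move=> j; rewrite !mxE addr_ge0 // le_max lexx orbT.
have := price_le (pos y z) (pos (- y) (- z)).
rewrite !price_posv opprD addrACA !posvB !dotvDl; lra.
Qed.

Hypothesis xbar_gt0 : vlt 0 (xbar I).
Hypothesis noarb : no_arbitrage I.

(** If [c + price I y] were negative, then [dotv y (payoff I x) - price I y]
    would be positive on the whole box, an arbitrage. *)
Lemma no_arbitrage_price c y :
  (forall x, Omega I x -> 0 <= c + dotv y (payoff I x)) -> 0 <= c + price I y.
Proof.
move=> pos; have [//|neg] := leP 0 (c + price I y).
have O0 := box_zero xbar_gt0.
have : dotv y (payoff I 0) - price I y = 0.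
  by apply: noarb O0 => x /pos; lra.
by have := pos _ O0; lra.
Qed.

Hypothesis c0y0_dominates : forall x, Omega I x ->
  - target I x <= ecp_c0 I + dotv (ecp_y0 I) (payoff I x).

Lemma superhedge_ge_phi_low c y :
  (forall x, Omega I x -> target I x <= c + dotv y (payoff I x)) ->
  phi_low I <= c + price I y.
Proof.
move=> sup; have : 0 <= (c + ecp_c0 I) + price I (y + ecp_y0 I).
  apply: no_arbitrage_price => x Ox; rewrite dotvDl.
  by have := sup x Ox; have := c0y0_dominates Ox; lra.
by have := priceD y (ecp_y0 I); rewrite /phi_low; lra.
Qed.

Hypothesis target_cpwa : cpwa_on (Omega I) (target I).
Hypothesis payoff_cpwa :
  forall j, cpwa_on (Omega I) (fun x => payoff I x 0 j).
Hypothesis phi_fin : (phi I (target I) < +oo)%E.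

Lemma superhedge_exists : exists c y,
  forall x, Omega I x -> target I x <= c + dotv y (payoff I x).
Proof.
have [_ [c [y [sup _]]] _] := ereal_inf_lt phi_fin.
by exists c, y.
Qed.

Lemma ecp_body_exists (S : {fset 'rV[R]_d}) :
  (forall x, x \in S -> Omega I x) -> exists t Xnext, ecp_body I S t Xnext.
Proof.
move=> SO; have [c [y sup]] := superhedge_exists.
(* A superhedge stays feasible when its cash part is raised; [B] is the cash
   that makes it satisfy the lower bound on the objective. *)
pose B := phi_low I - ecp_tau I - price I y.
have [c' [yp [ym min]]] : exists c' yp ym, lp_minimizer I S c' yp ym.
  apply: (@lp_minimizer_exists _ _ _ _ _ (Num.max c B) (posv y) (posv (- y))).
  split; [exact: posv_ge0|exact: posv_ge0| |].
    by rewrite /lp_obj -[leRHS]addrA -price_posv -lerBlDr le_max lexx orbT.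
  move=> x /SO /sup /le_trans; apply; rewrite posvB lerD2r.
  by rewrite le_max lexx.
have [v vmin] := slack_minimum target_cpwa payoff_cpwa xbar_gt0 (yp - ym).
have [[x Ox xv] _] := vmin.
pose t := EcpIterate c' yp ym (c' + v).
exists t; eexists; split=> //; exists v, [fset x]%fset; split=> //.
  by move=> z /fset1P ->.
by exists x => //; rewrite inE.
Qed.

Lemma ecp_body_Omega S t X x :
  ecp_body I S t X -> x \in X -> Omega I x.
Proof.
by move=> [_ [v [found [_ _ fO _ ->]]]]; rewrite !inE => /andP[/fO].
Qed.

Hypothesis delta_le1 : ecp_delta I <= 1.
Hypothesis eps_gt0 : 0 < ecp_eps I.

(** Induction on the number of cells without a point of [S `|` X]. The minimizer
    found in a pass that does not stop lies in such a cell, because the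
    inequality of a point in its cell would force [it_s t] to be nonnegative. It
    belongs to the next set of points because [ecp_delta I <= 1]. *)
Lemma ecp_terminates_from_Omega (S X : {fset 'rV[R]_d}) :
  (forall x, x \in S `|` X -> Omega I x)%fset -> ecp_terminates_from I S X.
Proof.
move=> SXO; have [T [q qP]] := slack_constant_on_cells target_cpwa payoff_cpwa.
pose cell x := [ffun i : T => q i x].
pose unseen (Y : {fset 'rV[R]_d}) := [pred k | k \notin map cell Y].
have [n] := ubnP #|unseen (S `|` X)%fset|.
elim: n => [|n IH] in S X SXO *; [by rewrite ltn0|rewrite ltnS => le_n].
split=> [|t X' body sneg]; first exact: ecp_body_exists.
have [[[_ _ _ feas] _] [v [found [vmin sE fO [z zfound zv] X'E]]]] := body.
have [_ v_le] := vmin.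
have zX' : z \in X'.
  rewrite X'E !inE /= zfound zv -sE ler_niMl //.
  by rewrite ltW // (lt_trans sneg) // oppr_lt0.
have znew : cell z \in unseen (S `|` X)%fset.
  rewrite inE; apply/negP => /mapP[x xS /ffunP xz].
  have xzi i : q i x = q i z by have := xz i; rewrite !ffunE.
  have := qP (it_y t) x z (SXO x xS) (fO z zfound) xzi.
  rewrite zv => /(_ v_le) xv.
  have : 0 <= it_s t by rewrite sE -xv addrA subr_ge0; exact: feas.
  by rewrite leNgt (lt_trans sneg) // oppr_lt0.
apply: IH => [x|].
  rewrite inE => /orP[/SXO //|]; exact: ecp_body_Omega body.
apply: leq_trans le_n; apply: proper_card; apply/properP; split.
  apply/fintype.subsetP => k; rewrite !inE; apply: contra => /mapP[x xS ->].
  by apply: map_f; rewrite inE xS.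
exists (cell z) => //; rewrite !inE negbK; apply/map_f.
by rewrite inE zX' orbT.
Qed.

Lemma ecp_outcome_stop S X res :
  ecp_outcome_from I S X res ->
  (forall x, x \in S `|` X -> Omega I x)%fset ->
  exists t Y Xnext, [/\ res = ecp_finish I t Y, ecp_body I Y t Xnext,
    - ecp_eps I <= it_s t & forall x, x \in Y -> Omega I x].
Proof.
elim=> {S X res} [S X t X' body stop|S X t X' res body _ _ IH] SXO.
  by exists t, (S `|` X)%fset, X'.
apply: IH => x; rewrite inE => /orP[/SXO //|]; exact: ecp_body_Omega body.
Qed.

(** Subtracting the minimum of the slack from the cash part repairs all the
    inequalities that the relaxation left out. *)
Lemma ecp_shift_superhedges S t X :
  ecp_body I S t X -> forall x, Omega I x ->
  target I x <= it_c t - it_s t + dotv (it_y t) (payoff I x).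
Proof.
move=> [_ [v [_ [[_ v_le] -> _ _ _]]]] x /v_le; rewrite /slack; lra.
Qed.

Lemma ecp_UB_ge_price S t X :
  ecp_body I S t X -> it_c t - it_s t + price I (it_y t) <= ecp_UB I t.
Proof.
move=> [[[yp0 ym0 _ _] _] _]; have := price_le yp0 ym0.
by rewrite /ecp_UB /ecp_LB /lp_obj /it_y; lra.
Qed.

Lemma ecp_UB_ge_phi_low S t X :
  ecp_body I S t X -> phi_low I <= ecp_UB I t.
Proof.
move=> body; apply: le_trans (ecp_UB_ge_price body).
exact/superhedge_ge_phi_low/ecp_shift_superhedges/body.
Qed.

End algorithm.

(** * Borel measures and finitely supported probabilities *)

Section borel.
Context (R : realType) (d : nat).
Implicit Types (D : set 'rV[R]_d) (h : 'rV[R]_d -> R).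

Lemma open_borel (U : set 'rV[R]_d) :
  open U -> measurable (U : set (borel_rV R d)).
Proof. by move=> oU; exact: sub_sigma_algebra. Qed.

Lemma closed_borel D : closed D -> measurable (D : set (borel_rV R d)).
Proof.
move=> cD; rewrite -[D]setCK; apply: measurableC; apply: open_borel.
exact: closed_openC.
Qed.

Lemma continuous_borel h : continuous h ->
  measurable_fun setT (h : borel_rV R d -> R).
Proof.
move=> /continuousP ch; apply: (measurability _ (RGenOpens.measurableE R)).
move=> _ [_ [a [b ->] <-]]; rewrite setTI; apply: open_borel.
exact/ch/interval_open.
Qed.

Lemma box_borel (b : 'rV[R]_d) : measurable (box b : set (borel_rV R d)).
Proof.
apply: closed_borel; rewrite (_ : box b = \bigcap_(i in [set: 'I_d])
    ([set x | 0 <= x 0 i] `&` [set x | x 0 i <= b 0 i])).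
  apply: closed_bigI => i _; apply: closedI.
    have /continuous_closedP := @coord_continuous R 1 d 0 i.
    by move=> /(_ [set y | 0 <= y]); apply; exact: closed_ge.
  have /continuous_closedP := @coord_continuous R 1 d 0 i.
  by move=> /(_ [set y | y <= b 0 i]); apply; exact: closed_le.
apply/seteqP; split=> x /= => [[x0 xb] i _|xi].
  by split=> //=; have := x0 i; rewrite mxE.
by split=> i; have [] := xi i Logic.I; rewrite ?mxE.
Qed.

Lemma cpwa_borel (b : 'rV[R]_d) h : cpwa_on (box b) h ->
  measurable_fun (box b : set (borel_rV R d)) h.
Proof.
move=> /cpwa_continuous[h' ch' hh'].
apply: (@eq_measurable_fun _ _ _ _ _ (h' : borel_rV R d -> R)).
  by move=> x xb; rewrite hh'.
by apply: measurable_funTS; exact: continuous_borel.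
Qed.

Lemma cpwa_integrable (b : 'rV[R]_d) h (mu : probability (borel_rV R d) R) :
  cpwa_on (box b) h -> mu.-integrable (box b) (EFin \o h).
Proof.
move=> hcpwa; apply: measurable_bounded_integrable.
- exact: box_borel.
- exact: (le_lt_trans (probability_le1 _ (box_borel b)) (ltry _)).
- exact: cpwa_borel.
have [h' ch' hh'] := cpwa_continuous hcpwa.
have /compact_bounded[M [Mreal Mh]] : compact (h' @` box b).
  apply: continuous_compact; last exact: box_compact.
  exact: continuous_subspaceT.
exists M; split=> // N MN x /= xb; rewrite hh' ?inE //.
by apply: Mh => //; exists x.
Qed.

End borel.

Section weighted_dirac.
Context (R : realType) (d : nat).
Variables (X : {fset 'rV[R]_d}) (w : 'rV[R]_d -> R).
Hypothesis w_ge0 : forall x, x \in X -> 0 <= w x.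

Let atom (k : nat) : borel_rV R d := nth 0 (X : seq 'rV[R]_d) k.
Let weight (k : nat) : {nonneg R} := NngNum (normr_ge0 (w (atom k))).

(** The weights are taken in absolute value because scaled measures carry the
    sign of the factor in its type; [weightE] removes the absolute value. *)
Definition dirac_sum : {measure set (borel_rV R d) -> \bar R} :=
  msum (fun k => mscale (weight k) (dirac (atom k))) (size (X : seq _)).

Let weightE (k : 'I_(size (X : seq 'rV[R]_d))) : (weight k)%:num = w (atom k).
Proof. by apply/ger0_norm/w_ge0/mem_nth. Qed.

Lemma dirac_sumE (A : set (borel_rV R d)) : measurable A ->
  dirac_sum A = (\sum_(x <- X) (w x)%:E * @dirac _ (borel_rV R d) x R A)%E.
Proof.
move=> mA; rewrite (big_nth 0) big_mkord; apply: eq_bigr => k _.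
by rewrite -weightE.
Qed.

Lemma ge0_integral_dirac_sum (D : set (borel_rV R d))
    (f : borel_rV R d -> \bar R) :
  measurable D -> (forall x, x \in X -> D x) -> measurable_fun D f ->
  (forall x, D x -> 0 <= f x)%E ->
  (\int[dirac_sum]_(x in D) f x = \sum_(x <- X) (w x)%:E * f x)%E.
Proof.
move=> mD XD mf f0; rewrite ge0_integral_measure_sum //.
rewrite (big_nth 0) big_mkord; apply: eq_bigr => k _.
rewrite ge0_integral_mscale // weightE integral_dirac // diracE.
rewrite mem_set ?mul1e //.
exact/XD/mem_nth.
Qed.

(** Sums of measures are integrated for nonnegative functions, hence the split
    into positive and negative parts. *)
Lemma integral_weighted_dirac (mu : probability (borel_rV R d) R)
    (D : set (borel_rV R d)) (f : borel_rV R d -> R) :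
  is_weighted_dirac X w mu -> measurable D -> (forall x, x \in X -> D x) ->
  measurable_fun D f ->
  (\int[mu]_(x in D) (f x)%:E = (\sum_(x <- X) w x * f x)%:E)%E.
Proof.
move=> muE mD XD mf.
rewrite (eq_measure_integral dirac_sum); last first.
  by move=> A mA _; exact: etrans (muE A mA) (esym (dirac_sumE mA)).
have mfE : measurable_fun D (EFin \o f) by exact/measurable_EFinP.
rewrite integralE !ge0_integral_dirac_sum //; last 2 first.
- exact: measurable_funeneg.
- exact: measurable_funepos.
rewrite [X in (X - _)%E](_ : _ = (\sum_(x <- X) w x * Num.max (f x) 0)%:E).
  rewrite [X in (_ - X)%E](_ : _ = (\sum_(x <- X) w x * Num.max (- f x) 0)%:E).
    rewrite -EFinB -sumrB; congr EFin; apply: eq_bigr => x _.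
    rewrite -mulrBr; congr (_ * _).
    by case: (leP (f x) 0) => ?; case: (leP (- f x) 0) => ?; lra.
  rewrite -sumEFin; apply: eq_bigr => x _.
  by rewrite EFinM funenegE EFin_max.
rewrite -sumEFin; apply: eq_bigr => x _.
by rewrite EFinM funeposE EFin_max.
Qed.

Lemma weighted_dirac_exists :
  \sum_(x <- X) w x = 1 ->
  exists mu : probability (borel_rV R d) R, is_weighted_dirac X w mu.
Proof.
move=> w1.
have dT : dirac_sum setT = 1%E.
  rewrite dirac_sumE // -w1 -sumEFin; apply: eq_bigr => x _.
  by rewrite diracT mule1.
(* Normalizing a measure of mass 1 does not change it, and makes it a
   probability. *)
exists (mnormalize dirac_sum (dirac (0 : borel_rV R d))).
move=> A mA; rewrite -dirac_sumE //=; rewrite /mnormalize dT onee_eq0 /=.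
by rewrite invr1 mule1.
Qed.

End weighted_dirac.

(** * Bounds on the integrals of the target, and the theorem *)

Section Q_bounds.
Context (R : realType) (d m : nat) (I : ecp_input R d m).
Hypothesis target_cpwa : cpwa_on (Omega I) (target I).
Hypothesis payoff_cpwa :
  forall j, cpwa_on (Omega I) (fun x => payoff I x 0 j).

(** Integrate the superhedging inequality: [nu] prices each payoff between
    [pi_lo I] and [pi_hi I], so it prices the portfolio at most at
    [price I y]. *)
Lemma Qset_integral_le (nu : probability (borel_rV R d) R) c y :
  Qset I nu ->
  (forall x, Omega I x -> target I x <= c + dotv y (payoff I x)) ->
  (integral_target I nu <= (c + price I y)%:E)%E.
Proof.
move=> [nu1 nuQ] sup.
have mO : measurable (Omega I : set (borel_rV R d)) := box_borel (xbar I).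
have intg j : nu.-integrable (Omega I) (fun x => (payoff I x 0 j)%:E).
  exact: (cpwa_integrable nu (payoff_cpwa j)).
have intyg j : nu.-integrable (Omega I)
    (fun x => ((y 0 j)%:E * (payoff I x 0 j)%:E)%E).
  exact: integrableZl.
have intc : nu.-integrable (Omega I) (fun=> c%:E).
  exact: finite_measure_integrable_cst.
have intcE : (\int[nu]_(x in Omega I) c%:E)%E = c%:E.
  rewrite -[RHS]mule1; apply: etrans (integral_cst nu mO _) _.
  by congr (_ * _)%E.
have intsum : nu.-integrable (Omega I)
    (fun x => (\sum_(j < m) (y 0 j)%:E * (payoff I x 0 j)%:E)%E).
  by apply: integrable_sum => // j _; exact: intyg.
have -> : (c + price I y)%:E = (c%:E + (price I y)%:E)%E by [].
apply: (@le_trans _ _ (\int[nu]_(x in Omega I)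
    (c%:E + \sum_(j < m) (y 0 j)%:E * (payoff I x 0 j)%:E))%E).
  apply: le_integral => //.
  - exact: (cpwa_integrable nu target_cpwa).
  - exact: integrableD.
  move=> x; rewrite inE => Ox; under eq_bigr do rewrite -EFinM.
  by rewrite sumEFin -EFinD lee_fin; exact: sup.
rewrite integralD // intcE leeD2l //.
rewrite integral_sum // -sumEFin; apply: lee_sum => j _.
rewrite integralZl //; have [] := nuQ j.
have /fineK <- : (\int[nu]_(x in Omega I) (payoff I x 0 j)%:E)%E \is a fin_num.
  exact: integrable_fin_num.
rewrite -EFinM !lee_fin; set G := fine _ => lo hi.
case: (leP (y 0 j) 0) => y0.
  by rewrite max_l ?oppr_ge0 // mul0r sub0r mulNr opprK ler_wnM2l.
by rewrite max_r ?oppr_le0 ?(ltW y0) // mul0r subr0 ler_wpM2l // ltW.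
Qed.

Lemma Qset_weighted_dirac (X : {fset 'rV[R]_d}) w
    (mu : probability (borel_rV R d) R) :
  (forall x, x \in X -> Omega I x) -> weights_feasible I X w ->
  is_weighted_dirac X w mu ->
  Qset I mu /\ integral_target I mu = (weights_value I X w)%:E.
Proof.
move=> XO [w1 lo hi w0] muE.
have mO : measurable (Omega I : set (borel_rV R d)) := box_borel (xbar I).
have intE h : cpwa_on (Omega I) h ->
    (\int[mu]_(x in Omega I) (h x)%:E)%E = (\sum_(x <- X) w x * h x)%:E.
  move=> hcpwa; apply: (integral_weighted_dirac w0) => //.
  exact: cpwa_borel hcpwa.
split; last exact: intE.
split=> [|j].
  rewrite muE // -w1 -sumEFin big_seq [RHS]big_seq; apply: eq_bigr => x xX.
  by rewrite diracE mem_set ?mule1 //; exact: XO.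
rewrite intE // !lee_fin; have := lo j; have := hi j.
by rewrite summxE; under eq_bigr do rewrite mxE.
Qed.

End Q_bounds.

Theorem corollary3p1 (R : realType) (d m : nat) (I : ecp_input R d m)
    (xbar_gt0 : vlt 0 (xbar I))
    (target_cpwa : cpwa_on (Omega I) (target I))
    (payoff_cpwa : forall j, cpwa_on (Omega I) (fun x => payoff I x 0 j))
    (pi_le : vle (pi_lo I) (pi_hi I))
    (X0_Omega : forall x, x \in ecp_X0 I -> Omega I x)
    (eps_gt0 : 0 < ecp_eps I)
    (tau_gt0 : 0 < ecp_tau I)
    (delta_gt0 : 0 < ecp_delta I)
    (delta_le1 : ecp_delta I <= 1)
    (c0y0_dominates : forall x, Omega I x ->
       - target I x <= ecp_c0 I + dotv (ecp_y0 I) (payoff I x))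
    (phi_fin : (phi I (target I) < +oo)%E)
    (phiN_fin : (phi I (fun x => (- target I x)%R) < +oo)%E)
    (noarb : no_arbitrage I) :
  ecp_terminates I /\
  forall res, ecp_outcome I res ->
    exists UB LB c y X,
      res = EcpReturned UB LB c y X /\
      (ecp_eps I < ecp_tau I ->
        (exists w, weights_optimal I X w) /\
        forall w, weights_optimal I X w ->
          exists2 mu, is_weighted_dirac X w mu & eps_optimal I mu).
Proof.
have X0O x : (x \in fset0 `|` ecp_X0 I)%fset -> Omega I x.
  by rewrite fset0U => /X0_Omega.
split; first exact: ecp_terminates_from_Omega.
move=> res /ecp_outcome_stop /(_ X0O)[t [X [X' [-> body stop XO]]]].
have UB_low := ecp_UB_ge_phi_low pi_le xbar_gt0 noarb c0y0_dominates body.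
exists (ecp_UB I t), (ecp_LB I t), (it_c t - it_s t), (it_y t), X.
split=> [|eps_tau]; first by rewrite /ecp_finish ltNge UB_low.
have [minX _] := body.
have LB_gt : phi_low I - ecp_tau I < ecp_LB I t.
  by rewrite /ecp_UB in UB_low; lra.
have [w wf LB_le] := weights_strong_duality minX LB_gt.
have value_le w' :
    weights_feasible I X w' -> weights_value I X w' <= ecp_LB I t.
  by apply: weights_weak_duality; case: minX.
split; first by exists w; split=> // w' /value_le /le_trans; apply.
move=> w' [w'f w'max].
have [mu muE] : exists mu : probability (borel_rV R d) R,
    is_weighted_dirac X w' mu.
  by have [w1 _ _ w0] := w'f; exact: weighted_dirac_exists.
have [muQ muI] := Qset_weighted_dirac target_cpwa payoff_cpwa XO w'f muE.
exists mu => //; split=> //; rewrite muI.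
apply: (@le_trans _ _ ((ecp_UB I t)%:E - (ecp_eps I)%:E)%E).
  rewrite leeD2r //; apply: ge_ereal_sup => _ [nu nuQ <-].
  apply: le_trans (Qset_integral_le target_cpwa payoff_cpwa nuQ
    (ecp_shift_superhedges body)) _.
  by rewrite lee_fin; exact: ecp_UB_ge_price body.
rewrite -EFinB lee_fin; have := w'max w wf.
by move: LB_le; rewrite /ecp_UB /ecp_LB; lra.
Qed.
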